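(* Suppose the iterated function system $\mathcal{S}=\{S_i\}_{i=1}^k$ of similarities on $\mathbb{R}$ satisfies the weak separation condition and has self-similar set $K=[0,1]$. Then $\mathcal{S}$ satisfies the finite neighbour condition.
   Context: An iterated function system (IFS) $\mathcal{S}=\{S_i\}_{i=1}^k$ is a finite set of similarities $S_i(x)=r_ix+d_i:\mathbb{R}\to\mathbb{R}$ with $0<|r_i|<1$ and $k\ge 2$. Its self-similar set $K$ is the unique non-empty compact set with $K=\bigcup_{j=1}^k S_j(K)$. Words: $\Sigma=\{1,\dots,k\}$ and $\Sigma^*$ is the set of all finite words on $\Sigma$ (the empty word corresponds to the identity map, with ratio $1$). For $\sigma=(\sigma_1,\dots,\sigma_j)$ put $S_\sigma=S_{\sigma_1}\circ\cdots\circ S_{\sigma_j}$, $r_\sigma=\prod_{i=1}^j r_{\sigma_i}$ and (for $j\ge1$) $\sigma^-=(\sigma_1,\dots,\sigma_{j-1})$. For $\alpha>0$ let $\Lambda_\alpha=\{\sigma\in\Sigma^*: |r_\sigma|<\alpha\le |r_{\sigma^-}|\}$. Weak separation condition: there is some $x_0\in\mathbb{R}$ and an integer $N$ (or, equivalently, for all $x_0$ there is some $N$) such that for any $\alpha>0$ and any finite word $\tau$, any closed ball of radius $\alpha$ contains no more than $N$ distinct points of the form $S_\sigma(S_\tau(x_0))$ with $\sigma\in\Lambda_\alpha$. Net intervals and neighbour sets: for $\alpha>0$ let $h_1<\dots<h_{s(\alpha)}$ be the distinct elements of $\{S_\sigma(0),S_\sigma(1):\sigma\in\Lambda_\alpha\}$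 and $\mathcal{F}_\alpha=\{[h_j,h_{j+1}]:1\le j<s(\alpha),\ (h_j,h_{j+1})\cap K\ne\emptyset\}$ (net intervals of generation $\alpha$). For $\Delta\in\mathcal{F}_\alpha$, $T_\Delta(x)=rx+a$ is the unique such map with $r>0$ and $T_\Delta([0,1])=\Delta$. The neighbour set of $\Delta\in\mathcal{F}_\alpha$ is the set of maps $V_\alpha(\Delta)=\{T_\Delta^{-1}\circ S_\sigma:\sigma\in\Lambda_\alpha,\ S_\sigma([0,1])\supseteq\Delta\}$. Finite neighbour condition: the collection of all neighbour sets $\{V_\alpha(\Delta):\alpha>0,\ \Delta\in\mathcal{F}_\alpha\}$ is finite. *)

(* Defs.v *)
From HB Require Import structures.
From mathcomp Require Import all_boot all_order all_algebra.
From mathcomp Require Import all_classical all_reals all_analysis.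
Set Implicit Arguments.
Unset Strict Implicit.
Unset Printing Implicit Defensive.
Import Order.TTheory GRing.Theory Num.Theory.
Import numFieldNormedType.Exports.
Local Open Scope card_scope.
Local Open Scope classical_set_scope.
Local Open Scope ring_scope.

Record ifs (R : realType) := Ifs {
  ifs_size : nat;
  ratio : 'I_ifs_size -> R;
  offset : 'I_ifs_size -> R;
  ifs_size_ge2 : (2 <= ifs_size)%N;
  ratio_bound : forall i, 0 < `|ratio i| < 1 }.

Section IteratedFunctionSystem.
Context {R : realType} (S : ifs R).
Implicit Types (alpha x : R) (K Delta : set R).

Definition ifs_map (i : 'I_(ifs_size S)) (x : R) : R := ratio i * x + offset i.

(* Hutchinson's theorem: exactly one set K has this property. *)
Definition self_similar_set K : Prop :=
  [/\ K !=set0, compact K & K = \bigcup_(i : 'I_(ifs_size S)) (ifs_map i @` K)].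

Definition word := seq 'I_(ifs_size S).
Implicit Types sigma tau : word.

Definition word_map sigma : R -> R :=
  foldr (fun i f => ifs_map i \o f) idfun sigma.

Definition word_ratio sigma : R := \prod_(i <- sigma) ratio i.

(* sigma^-; the value at the empty word is a dummy. *)
Definition parent sigma : word :=
  if sigma is i :: tau then belast i tau else [::].

(* The empty word has no parent, hence lies in no Lambda_alpha. *)
Definition Lambda alpha : set word :=
  [set sigma | [/\ sigma != [::], `|word_ratio sigma| < alpha
                 & alpha <= `|word_ratio (parent sigma)|]].

Definition weak_separation : Prop :=
  exists (x0 : R) (N : nat), forall alpha tau (c : R), 0 < alpha ->
    ([set word_map sigma (word_map tau x0) | sigma in Lambda alpha]
       `&` closed_ball c alpha) #<= `I_N.

Definition endpoints alpha : set R :=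
  [set word_map sigma 0 | sigma in Lambda alpha] `|`
  [set word_map sigma 1 | sigma in Lambda alpha].

(* h and h' are some h_j and h_{j+1} in the increasing enumeration of the
   finite set [endpoints alpha]. *)
Definition consecutive alpha (h h' : R) : Prop :=
  [/\ endpoints alpha h, endpoints alpha h', h < h'
    & forall g, endpoints alpha g -> ~~ (h < g < h')].

Definition net_intervals K alpha : set (set R) :=
  [set Delta | exists h h' : R, [/\ consecutive alpha h h',
     `]h, h'[ `&` K !=set0 & Delta = `[h, h']%classic]].

(* T_Delta and its inverse; see [norm_mapP], [norm_map_uniq], [norm_mapK]. *)
Definition norm_map Delta (x : R) : R :=
  (sup Delta - inf Delta) * x + inf Delta.

Definition norm_map_inv Delta (y : R) : R :=
  (y - inf Delta) / (sup Delta - inf Delta).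

Definition neighbour_set alpha Delta : set (R -> R) :=
  [set norm_map_inv Delta \o word_map sigma | sigma in
    [set sigma | Lambda alpha sigma /\ Delta `<=` word_map sigma @` `[0, 1]]].

Definition finite_neighbour K : Prop :=
  finite_set [set V : set (R -> R) | exists alpha Delta,
    [/\ 0 < alpha, net_intervals K alpha Delta & V = neighbour_set alpha Delta]].

End IteratedFunctionSystem.

Section NormMap.
Context {R : realType}.
Implicit Types (Delta : set R) (r a : R).

Lemma image_affine01 r a : 0 < r ->
  (fun x => r * x + a) @` `[0, 1] = `[a, r + a]%classic.
Proof.
move=> r0; apply/seteqP; split => [_ [x /=] + <-|y /=]; rewrite !in_itv /=.
  move=> /andP[x0 x1]; rewrite lerDr mulr_ge0 ?(ltW r0)//= lerD2r.
  by rewrite ler_piMr// ltW.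
move=> /andP[ay yr]; exists ((y - a) / r).
  rewrite /= in_itv /= divr_ge0 ?subr_ge0 ?(ltW r0)//=.
  by rewrite ler_pdivrMr// mul1r lerBlDr.
by rewrite mulrC divfK ?gt_eqF// subrK.
Qed.

Lemma norm_mapP (h h' : R) : h < h' ->
  0 < sup `[h, h'] - inf `[h, h'] /\
  norm_map `[h, h'] @` `[0, 1] = `[h, h']%classic.
Proof.
move=> hh'; rewrite /norm_map (sup_itvcc (ltW hh')) (inf_itvcc (ltW hh')).
rewrite subr_gt0; split=> //; by rewrite image_affine01 ?subr_gt0// subrK.
Qed.

Lemma norm_map_uniq Delta r a : 0 < r ->
  (fun x => r * x + a) @` `[0, 1] = Delta -> norm_map Delta = fun x => r * x + a.
Proof.
move=> r0 <-; have ar : a <= r + a by rewrite lerDr ltW.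
rewrite image_affine01// /norm_map (sup_itvcc ar) (inf_itvcc ar).
by rewrite addrK.
Qed.

Lemma norm_mapK Delta : 0 < sup Delta - inf Delta ->
  cancel (norm_map Delta) (norm_map_inv Delta) /\
  cancel (norm_map_inv Delta) (norm_map Delta).
Proof.
move=> D0; split=> x; rewrite /norm_map /norm_map_inv.
  by rewrite addrK mulrAC divff ?mul1r// gt_eqF.
by rewrite mulrC divfK ?gt_eqF// subrK.
Qed.

End NormMap.

(* Main.v *)
(* Write I_u for S_u([0, 1]). By weak separation, the number of maps
   S_u^-1 o S_v, over the v of the same generation as u such that I_v meets I_u,
   is bounded uniformly in u; if u0 attains the maximum, no word w u0 has
   neighbours beyond those of u0. If I_u and I_v have comparable lengths and
   overlap in a definite proportion, then some w = u t u0 with t of bounded length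
   has I_w inside I_v. As I_v is covered by its subintervals of the generation of
   w, some S_{v r} is S_w o g with g a neighbour of u0, so that S_u^-1 o S_v takes
   finitely many values.
   It remains to exclude tiny overlaps. Follow a pair of overlapping words from the
   root, always lengthening the word of larger ratio. Passing to a child leaves a
   small overlap unchanged or destroys it, because the ends of the I_i in the
   interior of [0, 1] are bounded away from 0 and 1; passing to a child from a
   definite overlap yields finitely many configurations, hence an overlap bounded
   below. So overlaps are uniformly definite, and S_u^-1 o S_v takes finitely many
   values over all overlapping u, v of one generation. Finally the ends of a net
   interval inside I_u are S_u(e) with e in a finite set. *)

Require Import Defs.
From HB Require Import structures.
From mathcomp Require Import all_boot all_order all_algebra.
From mathcomp Require Import all_classical all_reals all_analysis.
From mathcomp Require Import lra ring.
Set Implicit Arguments.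
Unset Strict Implicit.
Unset Printing Implicit Defensive.
Import Order.TTheory GRing.Theory Num.Theory.
Import numFieldNormedType.Exports.
Local Open Scope classical_set_scope.
Local Open Scope ring_scope.

(* [fraction.ratio] shadows the contraction ratios. *)
Local Notation ratio := Defs.ratio.

(** * Finiteness and elementary bounds *)

Lemma card_le_seq (T : choiceType) (A : set T) (N : nat) :
  (A #<= `I_N)%card -> exists2 s : seq T, (size s <= N)%N & A `<=` [set` s].
Proof.
move=> AN; have fA : finite_set A by apply: (card_le_finite AN).
have [n An] : exists n, (A #= `I_n)%card by apply/finite_setP.
exists (finmap.enum_fset (fset_set A)).
  by rewrite (card_fset_set An) -card_le_II -(card_le_eql An).
by move=> x Ax /=; rewrite in_fset_set// inE.
Qed.

Lemma subset_image_finite (I : finType) (T : Type) (F : I -> T) :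
  finite_set [set V : set T | V `<=` range F].
Proof.
apply: (@sub_finite_set _ _ (range (fun B : {set I} => F @` [set i | i \in B]))).
  move=> V VF; exists [set i : I | `[< V (F i) >]]%SET => //.
  apply/seteqP; split=> [_ [i /=] + <-|x Vx]; first by rewrite inE => /asboolP.
  by have [i _ Fi] := VF x Vx; exists i; rewrite //= inE Fi; apply/asboolP.
by apply: finite_image; apply: finite_finset.
Qed.

(** Entries where [f] is not positive are ignored, so the lemma applies to gaps and overlaps that
    may vanish. *)
Lemma pos_lower_bound (R : realType) (T : eqType) (s : seq T) (f : T -> R) :
  exists2 m, 0 < m & forall x, x \in s -> 0 < f x -> m <= f x.
Proof.
elim: s => [|y s [m m0 IH]]; first by exists 1.
have [fy|fy] := ltP 0 (f y); last first.
  exists m => // x; rewrite inE => /predU1P[->|/IH//].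
  by rewrite ltNge fy.
exists (Num.min m (f y)); first by rewrite lt_min m0.
move=> x; rewrite inE ge_min => /predU1P[->|/IH xm /xm ->//].
by rewrite lexx orbT.
Qed.

Lemma expr_small (R : realType) (q e : R) : 0 <= q < 1 -> 0 < e ->
  exists n : nat, q ^+ n < e.
Proof.
move=> /andP[q0 q1] e0.
have : q ^+ n @[n --> \oo] --> 0 by apply: cvg_expr; rewrite ger0_norm.
move=> /cvgrPdist_lt/(_ _ e0)[n _ /(_ n (leqnn n))].
by rewrite /= sub0r normrN ger0_norm ?exprn_ge0//; exists n.
Qed.

(** * Affine maps as pairs of coefficients *)

Section Affine.
Context {R : realType}.
Implicit Types g h k : R * R.

(* The pair (a, b) stands for the map x |-> a x + b. *)
Definition aff g (x : R) : R := g.1 * x + g.2.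
Definition acomp g h : R * R := (g.1 * h.1, g.1 * h.2 + g.2).
Definition ainv g : R * R := (g.1^-1, - (g.1^-1 * g.2)).

Lemma aff_comp g h x : aff (acomp g h) x = aff g (aff h x).
Proof. by rewrite /aff /acomp /=; ring. Qed.

Lemma acompA g h k : acomp g (acomp h k) = acomp (acomp g h) k.
Proof. by rewrite /acomp /=; congr (_, _); ring. Qed.

Lemma acompVK g h : g.1 != 0 -> acomp (ainv g) (acomp g h) = h.
Proof.
by case: g h => [a b] [c d] /= a0; rewrite /acomp/=; congr (_, _); field.
Qed.

Lemma acompKV g h : g.1 != 0 -> acomp g (acomp (ainv g) h) = h.
Proof.
by case: g h => [a b] [c d] /= a0; rewrite /acomp/=; congr (_, _); field.
Qed.

Lemma acompK g h : h.1 != 0 -> acomp (acomp g h) (ainv h) = g.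
Proof.
by case: g h => [a b] [c d] /= a0; rewrite /acomp/=; congr (_, _); field.
Qed.

Lemma ainv_comp g h : g.1 != 0 -> h.1 != 0 ->
  ainv (acomp g h) = acomp (ainv h) (ainv g).
Proof.
case: g h => [a b] [c d] /= a0 c0; rewrite /acomp/ainv/=.
by congr (_, _); field; rewrite ?a0 ?c0.
Qed.

End Affine.

(** * Word maps and the intervals I_w *)

Section Words.
Context {R : realType} (S : ifs R).
Implicit Types (u v w : word S) (i : 'I_(ifs_size S)) (x y : R).

Local Notation rho w := `|word_ratio w|.

Definition coef w : R * R := (word_ratio w, word_map w 0).

Lemma word_ratio_nil : word_ratio ([::] : word S) = 1.
Proof. by rewrite /word_ratio big_nil. Qed.

Lemma word_ratio1 i : word_ratio [:: i] = ratio i.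
Proof. by rewrite /word_ratio big_seq1. Qed.

Lemma word_ratio_cons i w : word_ratio (i :: w) = ratio i * word_ratio w.
Proof. by rewrite /word_ratio big_cons. Qed.

Lemma word_ratio_cat u v : word_ratio (u ++ v) = word_ratio u * word_ratio v.
Proof. by rewrite /word_ratio big_cat. Qed.

Lemma word_ratio_rcons u i : word_ratio (rcons u i) = word_ratio u * ratio i.
Proof. by rewrite -cats1 word_ratio_cat word_ratio1. Qed.

Lemma ratio_neq0 i : ratio i != 0.
Proof. by have /andP[] := ratio_bound i; rewrite normr_gt0. Qed.

Lemma word_ratio_neq0 w : word_ratio w != 0.
Proof.
elim: w => [|i w IH]; first by rewrite word_ratio_nil oner_neq0.
by rewrite word_ratio_cons mulf_neq0 ?ratio_neq0.
Qed.

Lemma rho_gt0 w : 0 < rho w.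
Proof. by rewrite normr_gt0 word_ratio_neq0. Qed.

Lemma rho_cat u v : rho (u ++ v) = rho u * rho v.
Proof. by rewrite word_ratio_cat normrM. Qed.

Lemma rho_le1 w : rho w <= 1.
Proof.
elim: w => [|i w IH]; first by rewrite word_ratio_nil normr1.
rewrite word_ratio_cons normrM mulr_ile1 ?normr_ge0//.
by have /andP[_ /ltW] := ratio_bound i.
Qed.

Lemma rho_rcons_le u i : rho (rcons u i) <= rho u.
Proof. by rewrite -cats1 rho_cat ler_piMr ?normr_ge0 ?rho_le1. Qed.

Lemma word_mapE w x : word_map w x = word_ratio w * x + word_map w 0.
Proof.
elim: w x => [|i w IH] x; first by rewrite word_ratio_nil mul1r addr0.
by rewrite /= IH /ifs_map word_ratio_cons; ring.
Qed.

Lemma word_map_cat u v x : word_map (u ++ v) x = word_map u (word_map v x).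
Proof. by elim: u => //= i u ->. Qed.

Lemma aff_coef w x : aff (coef w) x = word_map w x.
Proof. by rewrite [RHS]word_mapE. Qed.

Lemma coef_cat u v : coef (u ++ v) = acomp (coef u) (coef v).
Proof.
by rewrite /coef /acomp word_ratio_cat word_map_cat [word_map u _]word_mapE.
Qed.

Lemma coef_neq0 w : (coef w).1 != 0. Proof. exact: word_ratio_neq0. Qed.

Lemma parent_rcons u i : parent (rcons u i) = u.
Proof. by case: u => //= j u; rewrite belast_rcons. Qed.

(* [rel u v] is the map S_u^-1 o S_v. *)
Definition rel u v : R * R := acomp (ainv (coef u)) (coef v).

Lemma coef_rel u v : acomp (coef u) (rel u v) = coef v.
Proof. by rewrite /rel acompKV ?coef_neq0. Qed.

Lemma rel_eq u v g : coef v = acomp (coef u) g -> rel u v = g.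
Proof. by move=> vE; rewrite /rel vE acompVK ?coef_neq0. Qed.

Lemma rel_catl u w v : rel (u ++ w) v = acomp (ainv (coef w)) (rel u v).
Proof. by rewrite /rel coef_cat ainv_comp ?coef_neq0// acompA. Qed.

Lemma rel_cat2l u w v : rel (u ++ w) (u ++ v) = rel w v.
Proof. by apply: rel_eq; rewrite !coef_cat -acompA coef_rel. Qed.

Lemma word_map_rel u v x : word_map u (aff (rel u v) x) = word_map v x.
Proof. by rewrite -!aff_coef -aff_comp coef_rel. Qed.

Definition mid w : R := word_map w 2^-1.

(** I_w given by centre and radius, so that the sign of [word_ratio w] does not matter. *)
Definition in_itvw w : set R := [set y | `|y - mid w| <= rho w / 2].

Lemma word_map_sub w x y : word_map w x - word_map w y = word_ratio w * (x - y).
Proof. by rewrite word_mapE [word_map w y]word_mapE; ring. Qed.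

Lemma in_itvwE w x : in_itvw w (word_map w x) <-> 0 <= x <= 1.
Proof.
rewrite /in_itvw /= /mid word_map_sub normrM ler_pM2l ?rho_gt0// ler_norml.
by split=> /andP[? ?]; apply/andP; split; lra.
Qed.

Lemma word_map_surj w y : exists x, y = word_map w x.
Proof.
exists ((y - word_map w 0) / word_ratio w); rewrite word_mapE.
by field; rewrite word_ratio_neq0.
Qed.

Lemma image_word_map w : word_map w @` `[0, 1] = in_itvw w.
Proof.
apply/seteqP; split=> [_ [x /=] + <-|y].
  by rewrite in_itv /= => /in_itvwE.
by have [x ->] := word_map_surj w y => /in_itvwE x01; exists x; rewrite //= in_itv.
Qed.

Lemma ratio_lower_bound : exists2 q, 0 < q <= 1 & forall i, q <= `|ratio i|.
Proof.
have [q q0 qP] := pos_lower_bound (enum 'I_(ifs_size S)) (fun i => `|ratio i|).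
exists (Num.min q 1); first by rewrite lt_min q0 ltr01 ge_min lexx orbT.
move=> i; rewrite ge_min qP ?mem_enum//.
by case/andP: (ratio_bound i).
Qed.

Lemma ratio_upper_bound : exists2 q, 0 <= q < 1 & forall i, `|ratio i| <= q.
Proof.
have [q q0 qP] := pos_lower_bound (enum 'I_(ifs_size S)) (fun i => 1 - `|ratio i|).
exists (1 - Num.min q 1).
  by rewrite subr_ge0 ge_min lexx orbT gtrBl lt_min q0 ltr01.
move=> i; rewrite lerBrDr -lerBrDl ge_min qP ?mem_enum// subr_gt0.
by case/andP: (ratio_bound i).
Qed.

Lemma rho_le_expr q w : (forall i, `|ratio i| <= q) -> rho w <= q ^+ size w.
Proof.
move=> qP; elim: w => [|i w IH]; first by rewrite word_ratio_nil normr1.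
by rewrite word_ratio_cons normrM exprS ler_pM ?normr_ge0.
Qed.

Lemma words_finite n : exists s : seq (word S), forall w, (size w <= n)%N -> w \in s.
Proof.
elim: n => [|n [s sP]]; first by exists [:: [::]] => -[].
exists ([::] :: [seq i :: w | i <- enum 'I_(ifs_size S), w <- s]) => -[//|i w /= wn].
by rewrite inE; apply/allpairsP; exists (i, w); split; rewrite ?mem_enum ?sP.
Qed.

Hypothesis K01 : self_similar_set S `[0, 1]%classic.

Lemma itvw_cons w y : in_itvw w y -> exists i, in_itvw (rcons w i) y.
Proof.
have [x ->] := word_map_surj w y => /in_itvwE x01.
have [_ _ KE] := K01.
have : `[0, 1]%classic x by rewrite /= in_itv.
rewrite KE => -[i _ [z /=]]; rewrite in_itv /= => z01 <-.
exists i; have -> : word_map w (ifs_map i z) = word_map (rcons w i) z.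
  by rewrite -cats1 word_map_cat.
exact/in_itvwE.
Qed.

Lemma itvw_sub u v : in_itvw (u ++ v) `<=` in_itvw u.
Proof.
elim/last_ind: v => [|v i IH]; first by rewrite cats0.
rewrite -rcons_cat; move: (u ++ v) IH => w IH y yi; apply: IH; move: yi.
have [x ->] := word_map_surj (rcons w i) y => /in_itvwE x01.
rewrite -cats1 word_map_cat; apply/in_itvwE.
have [_ _ KE] := K01.
suff : `[0, 1]%classic (word_map [:: i] x) by rewrite /= in_itv.
by rewrite KE; exists i => //; exists x => //=; rewrite in_itv.
Qed.

Lemma itvw_cover w y n : in_itvw w y -> exists2 v, size v = n & in_itvw (w ++ v) y.
Proof.
move=> wy; elim: n => [|n [v vn vy]]; first by exists [::]; rewrite ?cats0.
have [i iy] := itvw_cons vy; exists (rcons v i); first by rewrite size_rcons vn.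
by rewrite -rcons_cat.
Qed.

(** Descend through children whose intervals contain [y]; the first one of ratio below [alpha] is in
    [Lambda alpha]. In the induction, [n] bounds the number of letters still to be added. *)
Lemma Lambda_cover alpha v y : 0 < alpha -> alpha <= rho v -> in_itvw v y ->
  exists2 w, Lambda alpha (v ++ w) & in_itvw (v ++ w) y.
Proof.
move=> a0; have [q q01 qP] := ratio_upper_bound.
have [n qn] := expr_small q01 a0.
have : rho v * q ^+ n < alpha.
  apply: le_lt_trans qn; rewrite ler_piMl ?rho_le1// exprn_ge0//.
  by case/andP: q01.
clear qn; elim: n v => [|n IH] v vn av vy.
  by move: vn; rewrite expr0 mulr1 ltNge av.
have [i iy] := itvw_cons vy.
have [ai|ia] := ltP (rho (rcons v i)) alpha.
  exists [:: i]; rewrite cats1//; split=> //; first by case: (v).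
  by rewrite parent_rcons.
have [|w wL wy] := IH (rcons v i) _ ia iy; last by exists (i :: w); rewrite -cat_rcons.
apply: le_lt_trans vn; rewrite exprS mulrA ler_pM2r//.
  by rewrite -cats1 rho_cat word_ratio1 ler_pM2l ?rho_gt0.
rewrite exprn_gt0// lt_neqAle eq_sym; case/andP: q01 => -> _; rewrite andbT.
by apply: contraTneq (qP i) => ->; rewrite -ltNge normr_gt0 ratio_neq0.
Qed.

Lemma Lambda_cat alpha v w : Lambda alpha w -> Lambda (rho v * alpha) (v ++ w).
Proof.
case: w => [[]//|i w] [_ wa aw]; split; first by case: (v).
  by rewrite rho_cat ltr_pM2l ?rho_gt0.
have -> : parent (v ++ i :: w) = v ++ parent (i :: w).
  by rewrite lastI -rcons_cat !parent_rcons.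
by rewrite rho_cat ler_pM2l ?rho_gt0.
Qed.

Lemma Lambda_rcons alpha v : Lambda alpha v ->
  exists u i, [/\ v = rcons u i, rho v < alpha & alpha <= rho u].
Proof.
case/lastP: v => [[]//|u i] [_ va]; rewrite parent_rcons => au.
by exists u, i.
Qed.

End Words.

(** * Weak separation bounds the number of neighbours *)

Section BoundedNeighbours.
Context {R : realType} (S : ifs R).
Implicit Types (u v w : word S) (i : 'I_(ifs_size S)) (x y : R).

Local Notation rho w := `|word_ratio w|.

Hypothesis K01 : self_similar_set S `[0, 1]%classic.

(** If all maps fixed [x], every point of [0, 1] would be within [q * D] of [x], where [D] is the
    largest distance from [x] to 0 or 1. Then [D] is 0 and both 0 and 1 equal [x]. *)
Lemma no_common_fixpoint x : exists i : 'I_(ifs_size S), ifs_map i x != x.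
Proof.
apply/not_existsP => fx.
have {}fx i : ifs_map i x = x by apply/eqP/negPn/negP/fx.
have [q /andP[q0 q1] qP] := ratio_upper_bound S.
have [_ _ KE] := K01.
pose D := Num.max `|x| `|1 - x|.
have distD y : 0 <= y <= 1 -> `|y - x| <= D.
  move=> /andP[y0 y1]; rewrite /D le_max.
  have [xy|yx] := leP x y; apply/orP; [right|left].
    by rewrite !ger0_norm ?lerD2r// subr_ge0// (le_trans xy).
  by rewrite ltr0_norm ?subr_lt0// opprB gtr0_norm ?(le_lt_trans y0)// gerBl.
have contr y : 0 <= y <= 1 -> `|y - x| <= q * D.
  move=> y01; have : `[0, 1]%classic y by rewrite /= in_itv.
  rewrite KE => -[i _ [z]]; rewrite /= in_itv /= => z01 <-.
  have -> : ifs_map i z - x = ratio i * (z - x).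
    by rewrite -[X in _ - X](fx i) /ifs_map; ring.
  by rewrite normrM ler_pM ?normr_ge0 ?distD.
have c0 : `|x| <= q * D by rewrite -normrN -sub0r contr// lexx ler01.
have c1 : `|1 - x| <= q * D by rewrite contr// lexx ler01.
have DD : D <= q * D by rewrite {1}/D ge_max c0.
have D0 : D <= 0 by nra.
have qD : q * D <= 0 by rewrite mulr_ge0_le0.
have := le_trans c0 qD; have := le_trans c1 qD.
rewrite !normr_le0 => /eqP x1 /eqP x0; move: x1; rewrite x0 subr0.
by move/eqP; rewrite oner_eq0.
Qed.

(** A ball of radius [Q * alpha] is covered by 2Q+1 balls of radius [alpha], centred at c + (j - Q)
    alpha. *)
Lemma ball_cover (N Q : nat) x :
  (forall alpha c, 0 < alpha -> ([set word_map v x | v in @Lambda R S alpha]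
       `&` closed_ball c alpha #<= `I_N)%card) ->
  exists M, forall alpha c, 0 < alpha ->
    exists2 s : seq R, (size s <= M)%N & forall v, Lambda alpha v ->
      `|word_map v x - c| <= Q%:R * alpha -> word_map v x \in s.
Proof.
move=> xN; exists (Q.*2.+1 * N)%N => alpha c a0.
suff [s sN sP] : exists2 s : seq R, (size s <= Q.*2.+1 * N)%N &
    forall v j, (j < Q.*2.+1)%N -> Lambda alpha v ->
      `|c + (j%:R - Q%:R) * alpha - word_map v x| <= alpha -> word_map v x \in s.
  exists s => // v Lv vc.
  (* The position of the point in units of [alpha], from the left end of the large ball; its integer
     part selects the small ball. *)
  pose t := (word_map v x - c) / alpha + Q%:R.
  have [t0 tQ] : 0 <= t /\ t <= Q.*2%:R.
    rewrite /t -addnn natrD; move: vc; rewrite -ler_pdivrMr//.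
    rewrite -{1}(gtr0_norm a0) -normfV -normrM ler_norml => /andP[? ?].
    by split; lra.
  have /andP[jt tj] := truncn_itv t0.
  apply: (sP v (Num.truncn t)) => //.
    by rewrite ltnS -(ler_nat R) (le_trans jt).
  have -> : word_map v x = c + (t - Q%:R) * alpha.
    by rewrite /t addrK divfK ?gt_eqF// addrC subrK.
  set j := Num.truncn t in jt tj *.
  have -> : c + (j%:R - Q%:R) * alpha - (c + (t - Q%:R) * alpha) = (j%:R - t) * alpha.
    by ring.
  rewrite normrM (gtr0_norm a0) ler_piMl ?(ltW a0)//.
  move: tj; rewrite -natr1 ler_norml => tj; apply/andP; split; lra.
elim: Q.*2.+1 => [|n [s sN sP]]; first by exists [::].
have [s' s'N s'P] := card_le_seq (xN alpha (c + (n%:R - Q%:R) * alpha) a0).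
exists (s' ++ s) => [|v j]; first by rewrite size_cat mulSn leq_add.
rewrite ltnS leq_eqVlt mem_cat => /predU1P[->|jn] Lv vc.
  apply/orP; left; apply: s'P; split; first by exists v.
  by rewrite closed_ballE.
by rewrite (sP v j) ?orbT.
Qed.

(** Intervals that merely touch I_u count too: in [rel_finite] a single common point is
    exhibited. *)
Definition neighbours u : set (R * R) :=
  [set rel u v | v in [set v | Lambda (rho u) v /\ in_itvw u `&` in_itvw v !=set0]].

(** S_v is determined by its values at two distinct points [x] and [p]. These values lie near
    S_u(0), and weak separation, with the empty word and with [[:: i]] as tau, bounds how many there
    are. *)
Lemma card_neighbours : weak_separation S ->
  exists M, forall u, exists2 s : seq (R * R),
    (size s <= M)%N & neighbours u `<=` [set` s].
Proof.
move=> [x [N xN]]; have [i ix] := no_common_fixpoint x.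
pose p := ifs_map i x; pose Q := (Num.truncn (Num.max `|p| `|x| + 2)).+1.
have near z u v : `|z| <= Num.max `|p| `|x| -> in_itvw u `&` in_itvw v !=set0 ->
    Lambda (rho u) v -> `|word_map v z - word_map u 0| <= Q%:R * rho u.
  move=> zm [y [uy vy]] [_ /ltW vu _].
  have [a ya] := word_map_surj u y; have [b yb] := word_map_surj v y.
  move: uy vy; rewrite {1}ya yb => /in_itvwE a01 /in_itvwE b01.
  (* Go through the common point [y]: it is within rho u of S_u(0), and within rho v (|z| + 1) of
     S_v(z), where rho v < rho u. *)
  apply: (@le_trans _ _ ((Num.max `|p| `|x| + 2) * rho u)); last first.
    by rewrite ler_pM2r ?rho_gt0// ltW// truncnS_gt.
  rewrite -(subrKA y) {1}yb ya !word_map_sub subr0.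
  apply: (le_trans (ler_normD _ _)); rewrite !normrM.
  have zb : `|z - b| <= Num.max `|p| `|x| + 1.
    by apply: (le_trans (ler_normB _ _)); rewrite lerD// ger0_norm; lra.
  have a1 : `|a| <= 1 by rewrite ger0_norm; lra.
  have := rho_gt0 u; have := rho_gt0 v; have := normr_ge0 (z - b); nra.
have [M1 M1P] := ball_cover Q (fun al c => xN al [::] c).
have [M2 M2P] := ball_cover Q (fun al c => xN al [:: i] c).
exists (M1 * M2)%N => u.
have [s1 s1M s1P] := M1P _ (word_map u 0) (rho_gt0 u).
have [s2 s2M s2P] := M2P _ (word_map u 0) (rho_gt0 u).
(* The affine map sending [x] to [X] and [p] to [Y], followed by S_u^-1. *)
pose g (X Y : R) : R * R :=
  let r := (X - Y) / (x - p) in acomp (ainv (coef u)) (r, X - r * x).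
exists [seq g X Y | X <- s1, Y <- s2].
  by rewrite size_allpairs leq_mul.
move=> _ [v [Lv uv] <-]; apply/allpairsP; exists (word_map v x, word_map v p).
split; [apply: s1P => //|apply: s2P => //|].
- by apply: near => //; rewrite le_max lexx orbT.
- by apply: near => //; rewrite le_max lexx.
have xp : x - p != 0 by rewrite subr_eq0 eq_sym.
rewrite /rel /g /= word_map_sub mulfK//; congr (acomp _ (_, _)).
by rewrite [word_map v x]word_mapE addrC addKr.
Qed.

(** A common prefix scales all ratios alike and cancels in S_u^-1 o S_w. *)
Lemma neighbours_cat u v : neighbours u `<=` neighbours (v ++ u).
Proof.
move=> _ [w [Lw [y [uy wy]]] <-]; exists (v ++ w); last exact: rel_cat2l.
split; first by rewrite rho_cat; apply: Lambda_cat.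
have [a ya] := word_map_surj u y; have [b yb] := word_map_surj w y.
move: uy wy; rewrite {1}ya yb => /in_itvwE a01 /in_itvwE b01.
by exists (word_map v y); split; [rewrite ya | rewrite yb];
  rewrite -word_map_cat; apply/in_itvwE.
Qed.

(* By [neighbours_cat], any word [u] with the maximal number of neighbours works. *)
Lemma saturated_word : weak_separation S ->
  exists u (s : seq (R * R)), forall v, neighbours (v ++ u) `<=` [set` s].
Proof.
move=> /card_neighbours[M MP].
pose P u n := exists s : seq (R * R),
  [/\ uniq s, size s = n & [set` s] `<=` neighbours u].
have PM u n : P u n -> (n <= M)%N.
  move=> [s [us <- su]]; have [t tM ut] := MP u.
  by apply: leq_trans tM; apply: uniq_leq_size => // g /su /ut.
have exP : exists n, `[< exists u, P u n >].
  by exists 0%N; apply/asboolP; exists [::], [::].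
have ubP n : `[< exists u, P u n >] -> (n <= M)%N by move=> /asboolP[u /PM].
case: (ex_maxnP exP ubP) => n /asboolP[u [s [us sn su]]] nmax.
exists u, s => v g vg; apply/negPn/negP => gs.
have : (n.+1 <= n)%N; last by rewrite ltnn.
apply: nmax; apply/asboolP; exists (v ++ u), (g :: s); split => /=.
- by rewrite gs.
- by rewrite sn.
- by move=> h; rewrite /= inE => /predU1P[->//|/su/neighbours_cat].
Qed.

End BoundedNeighbours.

(** * Overlaps of intervals, and finiteness of [rel] for definite overlaps *)

Section Overlaps.
Context {R : realType} (S : ifs R).
Implicit Types (u v w : word S) (i : 'I_(ifs_size S)) (x y : R).

Local Notation rho w := `|word_ratio w|.

(* When positive and at most both lengths, this is the length of the
   intersection of S_u([0, 1]) and S_v([0, 1]). *)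
Definition overlap u v : R := (rho u + rho v) / 2 - `|mid u - mid v|.

(** Symmetry allows only the first word to be lengthened below. *)
Lemma overlapC u v : overlap u v = overlap v u.
Proof. by rewrite /overlap (addrC (rho u)) distrC. Qed.

(** Relative to rho u, the overlap depends on S_u^-1 o S_v only, so finitely many such maps give
    finitely many relative overlaps. *)
Lemma overlap_rel u v :
  overlap u v =
    rho u * ((1 + `|(rel u v).1|) / 2 - `|2^-1 - aff (rel u v) 2^-1|).
Proof.
rewrite /overlap -[mid v](word_map_rel u) word_map_sub normrM.
have -> : rho v = rho u * `|(rel u v).1|.
  by rewrite /= -normrM mulrA divff ?word_ratio_neq0 // mul1r.
by ring.
Qed.

(** Shorten both intervals by [e / 2] at each end; they still meet. The witness is the centre of I_v
    if it lies in the shortened I_u, otherwise the nearest end of the latter. *)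
Lemma overlap_point e u v : e <= rho u -> e <= rho v -> e <= overlap u v ->
  exists x, `|x - mid u| <= (rho u - e) / 2 /\ `|x - mid v| <= (rho v - e) / 2.
Proof.
rewrite /overlap; set a := rho u; set b := rho v; set m := mid u; set m' := mid v.
move=> ea eb em.
have [mm|mm] := lerP `|m' - m| ((a - e) / 2).
  by exists m'; rewrite subrr normr0; split=> //; lra.
have [m'm|m'm] := leP m m'.
  exists (m + (a - e) / 2); rewrite (addrC m) addrK ger0_norm; last by lra.
  split=> //; move: em mm; rewrite distrC ger0_norm ?subr_ge0// => em mm.
  by rewrite ler_norml; apply/andP; split; lra.
exists (m - (a - e) / 2); rewrite (addrC m) addrK normrN ger0_norm; last by lra.
split=> //; move: em mm; rewrite distrC ltr0_norm ?subr_lt0// => em mm.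
by rewrite ler_norml; apply/andP; split; lra.
Qed.

(* The distance between the right ([b] false) or left ([b] true) ends of
   S_i([0, 1]) and [0, 1]. *)
Definition gap i (b : bool) : R :=
  (1 - `|ratio i|) / 2 - (-1) ^+ b * (mid [:: i] - 2^-1).

(** The expression inside the absolute value is, up to sign, the difference of the centres of the
    child and of I_v. The overlap shrinks by the gap on the side of I_v as long as this expression
    is nonnegative. *)
Lemma overlap_rcons u v i : exists b : bool,
  let P := (rho (rcons u i) + rho v) / 2 in
  overlap (rcons u i) v = P - `|P - (overlap u v - rho u * gap i b)|.
Proof.
have -> : overlap (rcons u i) v = (rho (rcons u i) + rho v) / 2 -
    `|mid u - mid v + word_ratio u * (mid [:: i] - 2^-1)|.
  congr (_ - `|_|); rewrite -word_map_sub /mid -cats1 word_map_cat.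
  by ring.
rewrite /overlap word_ratio_rcons normrM /gap.
set D := mid u - mid v; set c := mid [:: i] - _; set r := word_ratio u.
(* The end of [0, 1] that S_u sends towards I_v: it depends on the side of I_v and on whether S_u
   reverses orientation. *)
exists ((0 <= D) == (0 <= r)) => /=; congr (_ - _).
have [D0|D0] := leP 0 D; have [r0|r0] := leP 0 r; rewrite ?eqxx /= ?expr1 ?expr0.
- by rewrite (ger0_norm D0) (ger0_norm r0); congr `|_|; field.
- by rewrite (ger0_norm D0) (ltr0_norm r0); congr `|_|; field.
- by rewrite (ltr0_norm D0) (ger0_norm r0) -normrN; congr `|_|; field.
- by rewrite (ltr0_norm D0) (ltr0_norm r0) -normrN; congr `|_|; field.
Qed.

Hypothesis K01 : self_similar_set S `[0, 1]%classic.

Lemma gap_ge0 i b : 0 <= gap i b.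
Proof.
pose s : R := (-1) ^+ b.
have s1 : `|s| = 1 by rewrite normrX normrN1 expr1n.
(* The tested point is the end of I_i selected by [b]. *)
have : in_itvw ([::] : word S) (mid [:: i] + s * `|ratio i| / 2).
  apply: (@itvw_sub _ _ K01 [::] [:: i] _ _); rewrite /in_itvw /= addrAC subrr add0r.
  rewrite !normrM s1 mul1r normr_id word_ratio1 ler_wpM2l//.
  by rewrite ger0_norm ?invr_ge0.
rewrite /in_itvw /= word_ratio_nil normr1 mul1r .
rewrite -[X in X <= _]mul1r -[X in X * _]s1 -normrM.
move=> /(le_trans (ler_norm _)).
have ss : s * s = 1 by rewrite -expr2 sqrr_sign.
rewrite /gap -/s /mid /=; move: (ifs_map i _) => m.
have -> : s * (m + s * `|ratio i| / 2 - 2^-1) = s * (m - 2^-1) + s * s * `|ratio i| / 2.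
  by ring.
by rewrite ss => ?; lra.
Qed.

Lemma overlap_rcons_le u v i : overlap (rcons u i) v <= overlap u v.
Proof.
have [b ->] := overlap_rcons u v i.
have := rho_gt0 u; have := gap_ge0 i b => g0 r0.
have := mulr_ge0 (ltW r0) g0.
have := ler_norm ((rho (rcons u i) + rho v) / 2 - (overlap u v - rho u * gap i b)).
by lra.
Qed.

(** If the child still overlaps, the gap is below [e], hence zero. The old overlap is less than the
    mean of the two new lengths, so it is preserved. *)
Lemma overlap_small (e q : R) u v i :
  (forall i b, 0 < gap i b -> e <= gap i b) ->
  e <= q -> q * rho u <= rho (rcons u i) -> q * rho u <= rho v ->
  overlap u v < e * rho u -> 0 < overlap (rcons u i) v ->
  overlap (rcons u i) v = overlap u v.
Proof.
move=> eP eq qi qv ov; have [b ->] := overlap_rcons u v i.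
set P := (_ + _) / 2 => pos.
have r0 := rho_gt0 u.
have : rho u * gap i b < overlap u v.
  have := ler_norm (P - (overlap u v - rho u * gap i b)).
  by move: pos; lra.
move=> /lt_trans/(_ ov); rewrite mulrC ltr_pM2r// => ge.
have -> : gap i b = 0.
  apply/eqP; rewrite eq_le gap_ge0 andbT leNgt; apply/negP => /eP.
  by rewrite leNgt ge.
rewrite mul0r subr0 ger0_norm ?subKr// subr_ge0 /P.
by nra.
Qed.

Lemma rel_finite (q d : R) : weak_separation S -> 0 < d <= q -> q <= 1 ->
  exists H : seq (R * R), forall u v, q * rho u <= rho v -> q * rho v <= rho u ->
    d * rho u <= overlap u v -> rel u v \in H.
Proof.
move=> wsc /andP[d0 dq] q1.
have q0 : 0 < q by apply: lt_le_trans dq.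
have [p p01 pP] := ratio_upper_bound S.
(* With [n] letters appended, I_{ut} is shorter than half the guaranteed overlap, so it fits in I_v
   once it contains the deep point [x]. *)
have [n pn] := expr_small p01 (divr_gt0 d0 (ltr0n R 2)).
have [u0 [s0 s0P]] := saturated_word K01 wsc.
have [sn snP] := words_finite S n.
(* As rho w >= m rho u >= q m rho v, the choice of [L] bounds the length of the word [r] that brings
   [v] to the generation of [w]. *)
have [m m0 mP] := pos_lower_bound sn (fun t => rho (t ++ u0)).
have [L pL] := expr_small p01 (mulr_gt0 q0 m0).
have [sL sLP] := words_finite S L.
(* S_u^-1 o S_v = S_{t u0} o g o S_r^-1, with [g] a neighbour map from the saturated list. *)
exists [seq acomp a (ainv (coef r)) |
  a <- [seq acomp (coef (t ++ u0)) g | t <- sn, g <- s0], r <- sL].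
move=> u v uv vu ov.
have ru := rho_gt0 u; have rv := rho_gt0 v.
have [||//|x [xu xv]] := overlap_point (e := d * rho u) (u := u) (v := v).
- by rewrite ler_piMl ?(ltW ru)// (le_trans dq).
- by apply: le_trans uv; rewrite ler_pM2r.
have [|t tn tx] := itvw_cover K01 n (w := u) (y := x).
  by rewrite /in_itvw /=; have := mulr_gt0 d0 ru; lra.
have tsn : t \in sn by rewrite snP ?tn.
have rt : rho (u ++ t) <= d / 2 * rho u.
  rewrite rho_cat mulrC ler_pM2r//.
  by apply: le_trans (ltW pn); rewrite -tn; apply: rho_le_expr.
pose w := (u ++ t) ++ u0.
have wv : rho w <= rho v.
  rewrite rho_cat; apply: (@le_trans _ _ (rho (u ++ t))).
    by rewrite ler_piMr ?rho_le1.
  by have := mulr_gt0 d0 ru; nra.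
pose z := word_map w 0.
have wz : in_itvw w z by apply/in_itvwE; rewrite lexx ler01.
have vz : in_itvw v z.
  have zt : in_itvw (u ++ t) z by apply: (itvw_sub K01) wz.
  have zx : `|z - x| <= d * rho u / 2.
    rewrite -(subrKA (mid (u ++ t))).
    apply: (le_trans (ler_normD _ _)); rewrite (distrC _ x).
    by move: zt tx; rewrite /in_itvw /=; lra.
  rewrite /in_itvw /= -(subrKA x) (le_trans (ler_normD _ _))//.
  by lra.
have [r Lr rz] := Lambda_cover K01 (rho_gt0 w) wv vz.
have g0 : rel w (v ++ r) \in s0.
  by apply: (s0P (u ++ t)); exists (v ++ r) => //; split=> //; exists z.
have rL : r \in sL.
  apply: sLP; case/lastP: r {rz g0} Lr => // r i Lr.
  have : rho w <= rho (v ++ r).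
    by case: Lr => _ _; rewrite -rcons_cat parent_rcons.
  rewrite size_rcons; apply: contraTT; rewrite -leqNgt -ltNge => Lr'.
  rewrite /w -catA !rho_cat.
  have mt : m <= rho t * rho u0.
    by rewrite -rho_cat mP ?rho_gt0.
  have rp : rho r < q * m.
    apply: le_lt_trans pL; apply: (le_trans (rho_le_expr r pP)).
    by apply: ler_wiXn2l => //; case/andP: p01 => // _ /ltW.
  apply: (@lt_le_trans _ _ (rho v * (q * m))); first by rewrite ltr_pM2l.
  by rewrite (mulrA (rho v)) (mulrC (rho v)) ler_pM// ?mulr_ge0// ltW.
apply/allpairsP; exists (acomp (coef (t ++ u0)) (rel w (v ++ r)), r).
split=> //.
  by apply/allpairsP; exists (t, rel w (v ++ r)).
rewrite /= -[LHS](acompK _ (coef_neq0 r)); congr acomp.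
rewrite {1}/rel -acompA -coef_cat -(coef_rel w (v ++ r)) acompA.
by rewrite /w -catA (coef_cat u) [acomp (ainv _) _]acompVK ?coef_neq0.
Qed.

(** * Following pairs of words from the root *)

Inductive reach : word S -> word S -> Prop :=
| reach_nil : reach [::] [::]
| reach_sym u v : reach u v -> reach v u
| reach_rcons u v i : reach u v -> rho v <= rho u -> reach (rcons u i) v.

(** Undo the last letter of the word whose parent has the smaller ratio; the hypotheses persist for
    the shorter pair. *)
Lemma reach_parents u v :
  (forall u' i, u = rcons u' i -> rho v <= rho u') ->
  (forall v' i, v = rcons v' i -> rho u <= rho v') -> reach u v.
Proof.
have [n] := ubnP (size u + size v); elim: n u v => // n IH u v.
have step u1 i v1 : (size u1 + size v1 < n)%N -> rho v1 <= rho u1 ->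
    (forall v' j, v1 = rcons v' j -> rho u1 <= rho v') -> reach (rcons u1 i) v1.
  move=> sz vu Hv; apply: reach_rcons => //; apply: IH => // u' j uE.
  by rewrite (le_trans vu)// uE rho_rcons_le.
case/lastP: u => [|u i]; case/lastP: v => [|v j] sz Hu Hv.
- exact: reach_nil.
- apply/reach_sym/step; [by move: sz; rewrite addnC size_rcons|exact: (Hv v j)|].
  by move=> [|? ?].
- apply: step; [by move: sz; rewrite size_rcons|exact: (Hu u i)|].
  by move=> [|? ?].
have vu := Hu u i erefl; have uv := Hv v j erefl.
(* Here [u] and [v] denote the parents of the original words. *)
have [le|/ltW le] := leP (rho u) (rho v).
  apply: step => // [|_ _ /rcons_inj[<- _]//].
  by move: sz; rewrite size_rcons.
apply/reach_sym/step => // [|_ _ /rcons_inj[<- _]//].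
by move: sz; rewrite addnC size_rcons.
Qed.

Lemma reach_Lambda alpha u v : Lambda alpha u -> Lambda alpha v -> reach u v.
Proof.
move=> [_ ua au] [_ va av]; apply: reach_parents => w i wE.
  by move: au; rewrite wE parent_rcons; apply/le_trans/ltW.
by move: av; rewrite wE parent_rcons; apply/le_trans/ltW.
Qed.

Lemma reach_comparable (q : R) u v : 0 < q <= 1 -> (forall i, q <= `|ratio i|) ->
  reach u v -> q * rho u <= rho v /\ q * rho v <= rho u.
Proof.
move=> /andP[q0 q1] qP; elim=> [|{}u {}v _ []//|{}u {}v i _ [uv vu] le].
  by rewrite word_ratio_nil normr1 mulr1.
split; first by apply: le_trans uv; rewrite ler_pM2l ?rho_rcons_le.
rewrite word_ratio_rcons normrM mulrC.
by apply: ler_pM => //; exact: ltW.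
Qed.

(** Induction along [reach]: a small overlap that survives is unchanged, so the old bound carries
    over; a definite one leaves finitely many positive relative overlaps for the child, bounded
    below by [c]. *)
Lemma reach_overlap : weak_separation S -> exists2 c, 0 < c &
  forall u v, reach u v -> 0 < overlap u v ->
    c * rho u <= overlap u v /\ c * rho v <= overlap u v.
Proof.
move=> wsc; have [q /andP[q0 q1] qP] := ratio_lower_bound S.
have [e e0 eP] := pos_lower_bound
  [seq (i, b) | i <- enum 'I_(ifs_size S), b <- [:: true; false]]
  (fun ib => gap ib.1 ib.2).
pose d := Num.min e q.
have d0 : 0 < d by rewrite lt_min e0.
have dq : d <= q by rewrite ge_min lexx orbT.
have gapP i b : 0 < gap i b -> d <= gap i b.
  move=> g; rewrite ge_min (eP (i, b))//.
  by apply/allpairsP; exists (i, b); rewrite mem_enum; case: b {g}.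
have [|H HP] := rel_finite wsc _ q1 (d := d); first by rewrite d0.
pose phi (g : R * R) := (1 + `|g.1|) / 2 - `|2^-1 - aff g 2^-1|.
have [c c0 cP] := pos_lower_bound
  [seq acomp (ainv (coef [:: i])) g | i <- enum 'I_(ifs_size S), g <- H] phi.
(* The 1 serves the root pair, whose overlap is 1. The factor [q] passes from the child to [v], as q
   rho v <= q rho u <= rho (rcons u i). *)
exists (Num.min (c * q) 1); first by rewrite lt_min mulr_gt0 ?ltr01.
move=> u v; elim=> [|{}u {}v _ IH|{}u {}v i uv IH vu ov].
- rewrite /overlap subrr normr0 word_ratio_nil normr1 => _.
  have : Num.min (c * q) 1 <= 1 by rewrite ge_min lexx orbT.
  by split; lra.
- by rewrite overlapC => /IH[].
have [uqv vqu] : q * rho u <= rho v /\ q * rho v <= rho u.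
  by apply: reach_comparable => //; rewrite q0.
have ui : q * rho u <= rho (rcons u i).
  by rewrite word_ratio_rcons normrM mulrC ler_pM2l ?rho_gt0.
have [le|lt] := leP (d * rho u) (overlap u v); last first.
  rewrite (overlap_small gapP dq ui uqv lt ov).
  have [cu cv] := IH (lt_le_trans ov (overlap_rcons_le _ _ _)).
  split=> //; apply: le_trans cu; rewrite ler_pM2l ?rho_rcons_le//.
  by rewrite lt_min mulr_gt0 ?ltr01.
have cle : c * rho (rcons u i) <= overlap (rcons u i) v.
  rewrite overlap_rel mulrC ler_pM2l ?rho_gt0// cP//.
    apply/allpairsP; exists (i, rel u v); rewrite mem_enum HP//.
    by rewrite -cats1 rel_catl.
  by move: ov; rewrite overlap_rel pmulr_rgt0 ?rho_gt0.
split; apply: le_trans cle.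
  rewrite ler_pM2r ?rho_gt0// ge_min; apply/orP; left.
  by rewrite ler_piMr// ltW.
apply: (@le_trans _ _ (c * (q * rho u))); last by rewrite ler_pM2l.
rewrite mulrA; apply: ler_pM => //; last by rewrite ge_min lexx.
by rewrite le_min ler01 mulr_ge0// ltW.
Qed.

Lemma rel_Lambda_finite : weak_separation S -> exists H : seq (R * R),
  forall alpha u v, Lambda alpha u -> Lambda alpha v -> 0 < overlap u v ->
    rel u v \in H.
Proof.
move=> wsc; have [q q01 qP] := ratio_lower_bound S.
have /andP[q0 q1] := q01.
have [c c0 cP] := reach_overlap wsc.
have [|H HP] := rel_finite wsc _ q1 (d := Num.min c q).
  by rewrite lt_min c0 q0 ge_min lexx orbT.
exists H => alpha u v ua va ov; have uv := reach_Lambda ua va.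
have [uqv vqu] := reach_comparable q01 qP uv; apply: HP => //.
have [cu _] := cP _ _ uv ov; apply: le_trans cu.
by rewrite ler_pM2r ?rho_gt0// ge_min lexx.
Qed.

End Overlaps.

(** * Net intervals and the conclusion *)

Section NetIntervals.
Context {R : realType} (S : ifs R).
Implicit Types (u v w : word S) (i : 'I_(ifs_size S)) (x y h : R).

Local Notation rho w := `|word_ratio w|.

Lemma overlap_gt0 u v h h' : h < h' ->
  in_itvw u h -> in_itvw u h' -> in_itvw v h -> in_itvw v h' -> 0 < overlap u v.
Proof.
rewrite /in_itvw /= !ler_norml => hh /andP[? ?] /andP[? ?] /andP[? ?] /andP[? ?].
by rewrite subr_gt0 ltr_norml; apply/andP; split; lra.
Qed.

(** For a positive overlap, [e] is the image of [a] under S_u^-1 o S_v. Otherwise I_u and I_v at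
    most touch, so [y] is an end of I_u and [e] is 0 or 1. *)
Lemma endpoints_rel (H : seq (R * R)) u v y a :
  (0 < overlap u v -> rel u v \in H) -> in_itvw u y -> y = word_map v a ->
  a \in [:: 0; 1] ->
  exists2 e, e \in [:: 0, 1 & [seq aff g b | g <- H, b <- [:: 0; 1]]] &
    y = word_map u e.
Proof.
move=> uvH uy yE a01.
have [ov|ov] := ltP 0 (overlap u v).
  exists (aff (rel u v) a); last by rewrite word_map_rel.
  by rewrite !inE; apply/orP; right; apply/orP; right; apply/allpairsP;
    exists (rel u v, a); rewrite /= uvH.
have vy : in_itvw v y.
  rewrite yE; apply/in_itvwE; move: a01; rewrite !inE.
  by case/orP => /eqP ->; rewrite ?lexx ?ler01.
have [b yb] := word_map_surj u y; exists b => //.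
have b01 : 0 <= b <= 1 by apply/(in_itvwE u); rewrite -yb.
have : rho u * 2^-1 <= rho u * `|b - 2^-1|.
  rewrite -normrM -word_map_sub -yb -/(mid u).
  have := ler_distD y (mid u) (mid v); rewrite (distrC (mid u) y).
  by move: ov vy; rewrite /overlap /in_itvw /=; lra.
rewrite ler_pM2l ?rho_gt0// => b2.
suff : (b == 0) || (b == 1) by rewrite !inE orbA => ->.
case/andP: b01 => b0 b1; move: b2.
have [le|lt] := leP 2^-1 b.
  by rewrite ger0_norm ?subr_ge0// => b2; apply/orP; right; apply/eqP; lra.
by rewrite ltr0_norm ?subr_lt0// => b2; apply/orP; left; apply/eqP; lra.
Qed.

Hypothesis K01 : self_similar_set S `[0, 1]%classic.

(** Cover an interior point by some I_u of this generation; the ends of I_u are endpoints, so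
    neither lies strictly between [h] and [h']. *)
Lemma net_interval_cover alpha h h' : 0 < alpha -> consecutive S alpha h h' ->
  `]h, h'[ `&` `[0, 1] !=set0 ->
  exists u, [/\ Lambda alpha u, in_itvw u h & in_itvw u h'].
Proof.
move=> a0 [hE _ hh' none] [x [/= xh x01]].
(* An endpoint exists, so [Lambda alpha] is nonempty and [alpha] is at most 1; the descent can start
   at the empty word. *)
have a1 : alpha <= rho ([::] : word S).
  rewrite word_ratio_nil normr1.
  by case: hE => -[v /Lambda_rcons[w [i [_ _ aw]]] _]; apply: (le_trans aw); apply: rho_le1.
have [|u ua ux] := Lambda_cover K01 a0 a1 (y := x).
  by apply/(in_itvwE [::]); rewrite in_itv /= in x01.
rewrite /= in ua ux; exists u.
have n0 := none (word_map u 0) (or_introl (ex_intro2 _ _ u ua erefl)).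
have n1 := none (word_map u 1) (or_intror (ex_intro2 _ _ u ua erefl)).
rewrite in_itv /= in xh; case/andP: xh => hx xh.
have m0 : mid u - word_map u 0 = word_ratio u / 2.
  by rewrite /mid word_map_sub subr0.
have m1 : word_map u 1 - mid u = word_ratio u / 2.
  by rewrite /mid word_map_sub; congr (_ * _); lra.
move: ux n0 n1; rewrite /in_itvw /= !negb_and -!leNgt !ler_norml.
move: (word_map u 0) (word_map u 1) (mid u) (word_ratio u) m0 m1 => e0 e1 m r m0 m1.
have [r0|r0] := leP 0 r; [rewrite ger0_norm//|rewrite ltr0_norm//].
  by move=> /andP[? ?] /orP[?|?] /orP[?|?]; split=> //; apply/andP; split; lra.
by move=> /andP[? ?] /orP[?|?] /orP[?|?]; split=> //; apply/andP; split; lra.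
Qed.

End NetIntervals.

Theorem theorem4p4 (R : realType) (S : ifs R) (K : set R)
    (hK : self_similar_set S K) (hK01 : K = `[0, 1]%classic)
    (hwsc : weak_separation S) :
  finite_neighbour S K.
Proof.
rewrite hK01 in hK *.
have [H HP] := rel_Lambda_finite hK hwsc.
pose E : seq R := [:: 0, 1 & [seq aff g b | g <- H, b <- [:: 0; 1]]].
pose L := [seq (g, e) | g <- H, e <- [seq (e, e') | e <- E, e' <- E]].
(* If h = S_u(e), h' = S_u(e') and g = S_u^-1 o S_v, then S_u cancels in T_Delta^-1 o S_v, which
   becomes [f (g, (e, e'))]. Every neighbour set is thus a subset of one finite set of maps. *)
pose f (p : (R * R) * (R * R)) x := (aff p.1 x - p.2.1) / (p.2.2 - p.2.1).
apply: (@sub_finite_set _ _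
    [set V | V `<=` range (fun j : 'I_(size L) => f (tnth (in_tuple L) j))]);
  last exact: subset_image_finite.
move=> V [alpha [Delta [a0 [h [h' [cons Kh ->]]] ->]]].
have [u [ua uh uh']] := net_interval_cover hK a0 cons Kh.
have [hE hE' hh' _] := cons.
have endE y : endpoints S alpha y -> in_itvw u y -> exists2 e, e \in E & y = word_map u e.
  by move=> yE uy; case: yE => -[v va vy];
    apply: (endpoints_rel (HP _ _ _ ua va) uy (esym vy)); rewrite !inE eqxx ?orbT.
have [e eE he] := endE _ hE uh; have [e' eE' he'] := endE _ hE' uh'.
move=> _ [v [va Dv] <-].
have vh : in_itvw v h.
  by rewrite -image_word_map; apply: Dv; rewrite /= in_itv /= lexx ltW.
have vh' : in_itvw v h'.
  by rewrite -image_word_map; apply: Dv; rewrite /= in_itv /= lexx ltW.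
have gH := HP _ _ _ ua va (overlap_gt0 hh' uh uh' vh vh').
have pL : (rel u v, (e, e')) \in L.
  by apply/allpairsP; exists (rel u v, (e, e')); split=> //; apply/allpairsP; exists (e, e').
have /tnthP[j jE] : (rel u v, (e, e')) \in in_tuple L by [].
exists j => //; apply/funext => x; rewrite -jE /f /=.
rewrite /norm_map_inv (sup_itvcc (ltW hh')) (inf_itvcc (ltW hh')).
rewrite -[word_map v x](word_map_rel u) he he' !word_map_sub.
by rewrite -mulf_div divff ?mul1r// word_ratio_neq0.
Qed.
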